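(* Let $D=(V,E)$ be a finite digraph without loops with $V\neq\emptyset$, let $H=(U,F)$ be a digraph (loops allowed), and let $\varsigma\colon E\to U$ be an $H$-colouring of $D$. Let $E=E_1\sqcup E_2$ be a partition of the arcs and $D_i=(V,E_i)$ for $i=1,2$. If every directed cycle contained in $D_2$ is an $H$-cycle, then $D$ has an $H$-semikernel modulo $E_1$ consisting of a single vertex.
   Context: An $H$-colouring of $D$ is a function $\varsigma\colon E\to U$. A walk $z_0z_1\dots z_k$ ($k\ge 1$) in $D$ is an $H$-walk if for each $1\le i\le k-1$, $\varsigma(z_{i-1}z_i)\varsigma(z_iz_{i+1})\in F$ (i.e. the colour sequence is a walk in $H$). A directed cycle is an $H$-cycle if the colours of its arcs, read cyclically, form a closed walk in $H$. A set $S\subseteq V$ is $H$-independent if there is no $H$-walk in $D$ between two distinct elements of $S$. Given the partition $E=E_1\sqcup E_2$, a set $S\subseteq V$ is an $H$-semikernel modulo $E_1$ if $S$ is $H$-independent and for every $z\in V\setminus S$: if there exists an $H$-walk from some vertex of $S$ to $z$ all of whose arcs lie in $E_2$, then there exists an $H$-walk in $D$ from $z$ to some vertex of $S$. *)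

(* Defs.v *)
From mathcomp Require Import all_boot.

Set Implicit Arguments.
Unset Strict Implicit.
Unset Printing Implicit Defensive.

(* D = (V, A) is given by its arc set A : {set V * V}; H = (U, F) is given by
   F : U -> U -> Prop, with U an arbitrary type. *)
Section HColouredDigraphs.
Variable V : finType.

Definition loopless (A : {set V * V}) : Prop := forall x, (x, x) \notin A.

Definition adj (A : {set V * V}) : rel V := [rel x y | (x, y) \in A].

Definition arc_of (A : {set V * V}) : Type := {e : V * V | e \in A}.

Definition mk_arc (A : {set V * V}) (x y : V) (xy : (x, y) \in A) : arc_of A :=
  exist _ (x, y) xy.

(* The vertex sequence z_0 z_1 ... z_k is x :: p, so that k = size p. *)
Definition walk (A : {set V * V}) (x : V) (p : seq V) (y : V) : Prop :=
  [/\ 0 < size p, path (adj A) x p & last x p = y].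

Definition dicycle (A : {set V * V}) (s : seq V) : Prop :=
  [/\ 0 < size s, cycle (adj A) s & uniq s].

Variables (U : Type) (F : U -> U -> Prop).
Variables (E : {set V * V}) (varsigma : arc_of E -> U).

Definition H_walk (x : V) (p : seq V) (y : V) : Prop :=
  walk E x p y /\
  forall a b c (ab : (a, b) \in E) (bc : (b, c) \in E),
    infix [:: a; b; c] (x :: p) -> F (varsigma (mk_arc ab)) (varsigma (mk_arc bc)).

Definition H_cycle (s : seq V) : Prop :=
  dicycle E s /\
  forall a b c (ab : (a, b) \in E) (bc : (b, c) \in E),
    a \in s -> b = next s a -> c = next s b ->
    F (varsigma (mk_arc ab)) (varsigma (mk_arc bc)).

Definition H_independent (S : {set V}) : Prop :=
  forall x y, x \in S -> y \in S -> x <> y -> ~ exists p, H_walk x p y.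

(* In a partition E = E1 + E2, the part E2 is E :\: E1. *)
Definition H_semikernel_mod (E1 : {set V * V}) (S : {set V}) : Prop :=
  H_independent S /\
  forall z, z \notin S ->
    (exists x p, [/\ x \in S, H_walk x p z & path (adj (E :\: E1)) x p]) ->
    exists y q, y \in S /\ H_walk z q y.

End HColouredDigraphs.

(* Main.v *)
Require Import Defs.
From mathcomp Require Import all_boot.
From mathcomp Require Import boolp.

Set Implicit Arguments.
Unset Strict Implicit.
Unset Printing Implicit Defensive.

(** Restrict [D2] to a terminal strong component, so that every arc lies on a
    directed cycle, and consider H-reachability as a preorder on arcs.  Let [T]
    be a terminal class of this preorder and [x] the head of an arc of [T].
    A transition [a -> x -> c] is an H-transition as soon as [c] reaches [a]
    without passing through [x]; hence the set [R] of vertices that can be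
    reached in [D2 - x] through arcs [x -> c] outside [T] avoids all heads of
    [T].  If [x] is not a singleton semikernel, then some H-walk leaves [x]
    through [R] towards another terminal class [T'].  Taking for [x'] any head
    of [T'] other than the vertex where [T'] is first entered from [x], the set
    [R'] attached to [(T', x')] is strictly contained in [R], so this process
    stops. *)

(** * Terminal classes and induction along paths *)

(** Take [y] reachable from [x] with fewest vertices reachable from it: by minimality every [z] it
    reaches has the same reachable set, which contains [y]. *)
Lemma connect_terminal (T : finType) (e : rel T) (x : T) :
  exists2 y, connect e x y & forall z, connect e y z -> connect e z y.
Proof.
have [y xy ymin] := arg_minnP (fun y => #|connect e y|) (connect0 e x).
exists y => // z yz.
have sub : connect e z \subset connect e y.
  by apply/subsetP => w zw; apply: connect_trans yz zw.
have /subset_leqif_card/geq_leqif := sub.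
rewrite (ymin _ (connect_trans xy yz)) => /esym/subsetP; apply.
exact: connect0.
Qed.

Lemma connect_ind_l (T : finType) (e : rel T) (y : T) (P : T -> Prop) :
  P y -> (forall x z, e x z -> connect e z y -> P z -> P x) ->
  forall x, connect e x y -> P x.
Proof.
move=> Py IH x /connectP[p]; elim: p x => [|z p IHp] x /=; first by move=> _ <-.
case/andP=> xz zp ylast; apply: (IH x z xz); last exact: IHp.
by apply/connectP; exists p.
Qed.

Lemma connect_ind_r (T : finType) (e : rel T) (x : T) (P : T -> Prop) :
  P x -> (forall y z, connect e x y -> e y z -> P y -> P z) ->
  forall y, connect e x y -> P y.
Proof.
move=> Px IH y /connectP[p + ->]; elim/last_ind: p => [//|p z IHp].
rewrite rcons_path last_rcons => /andP[xp pz].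
by apply: (IH _ _ _ pz (IHp xp)); apply/connectP; exists p.
Qed.

(** * Transitions between arcs in an abstract digraph *)

Section Transitions.
Variables (V : finType) (A : rel V) (ok : V -> V -> V -> bool).

Definition avoid (b : V) : rel V := [rel u v | [&& A u v, u != b & v != b]].

(** Arcs are pairs, and [ok a b c] permits the turn from [a -> b] into [b -> c]; connectivity of
    this relation is the preorder on arcs. *)
Definition transition : rel (V * V) :=
  [rel e f | [&& e.2 == f.1, A e.1 e.2, A f.1 f.2 & ok e.1 e.2 f.2]].

Definition heads (e : V * V) : {set V} :=
  [set x | [exists f, connect transition e f && (f.2 == x)]].

(** This is the set $R$ attached to $(T, x)$, where [e] represents the terminal class $T$. *)
Definition escape (e : V * V) (x : V) : {set V} :=
  [set v | [exists c, [&& A x c, ~~ connect transition e (x, c)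
                        & connect (avoid x) c v]]].

(** The semikernel condition for the singleton of [x], in terms of transitions. *)
Definition returning (x : V) : Prop :=
  forall e f, A e.1 e.2 -> e.1 = x -> connect transition e f -> f.2 != x ->
  exists g h, [/\ A g.1 g.2, g.1 = f.2, connect transition g h & h.2 = x].

Definition terminal_arc (e : V * V) : Prop :=
  A e.1 e.2 /\ forall f, connect transition e f -> connect transition f e.

Hypothesis A_irr : forall x, ~~ A x x.
Hypothesis A_cyclic : forall x y, A x y -> connect A y x.
Hypothesis ok_cycle : forall a b c,
  A a b -> A b c -> connect (avoid b) c a -> ok a b c.

Lemma headsP e x :
  reflect (exists2 f, connect transition e f & f.2 = x) (x \in heads e).
Proof.
rewrite inE; apply: (iffP existsP) => [[f /andP[ef /eqP fx]]|[f ef fx]].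
  by exists f.
by exists f; rewrite ef fx eqxx.
Qed.

Lemma escapeP e x v :
  reflect (exists c, [/\ A x c, ~~ connect transition e (x, c)
                       & connect (avoid x) c v]) (v \in escape e x).
Proof.
by rewrite inE; apply: (iffP existsP) => -[c]; [case/and3P|move/and3P];
  exists c.
Qed.

Lemma A_neq x y : A x y -> x != y.
Proof. by apply: contraTneq => ->. Qed.

Lemma avoid_neql b u v : connect (avoid b) u v -> v != b -> u != b.
Proof.
by move=> uv vb; move: u uv; apply: connect_ind_l => // x z /and3P[].
Qed.

Lemma avoid_neqr b u v : connect (avoid b) u v -> u != b -> v != b.
Proof.
by move=> uv ub; move: v uv; apply: connect_ind_r => // x z _ /and3P[].
Qed.

Lemma path_avoid b c p :
  path A c p -> b \notin c :: p -> connect (avoid b) c (last c p).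
Proof.
elim: p c => [|d p IH] c /=; first by rewrite connect0.
case/andP=> cd dp; rewrite inE negb_or eq_sym => /andP[cb bp].
apply: connect_trans (IH d dp bp); apply: connect1.
by move: bp; rewrite inE negb_or eq_sym /avoid /= cd cb => /andP[].
Qed.

Lemma transition_arc e f : A e.1 e.2 -> connect transition e f -> A f.1 f.2.
Proof.
by move=> Ae; move: f; apply: connect_ind_r => // f g _ /and4P[].
Qed.

(** A simple path from [b] back to [a] leaves [b] for good at its first arc, so [ok_cycle] applies
    to that arc. *)
Lemma transition_succ a b : A a b -> exists c, transition (a, b) (b, c).
Proof.
move=> ab; have /connectP[p0 p0P alast] := A_cyclic ab.
have nab := A_neq ab.
case/shortenP: p0P alast => -[|c p] /=; first by move=> _ _ _ ba; rewrite ba eqxx in nab.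
case/andP=> bc cp /andP[bNcp _] _ alast.
exists c; rewrite /transition /= eqxx ab bc; apply: ok_cycle => //.
by rewrite alast; apply: path_avoid.
Qed.

(** Cut the walk at its first entry into [x]. *)
Lemma transition_entry f g x : connect transition f g -> f.2 != x -> g.2 = x ->
  exists2 a, connect transition f (a, x) & connect (avoid x) f.2 a.
Proof.
move=> fg + gx; move: f fg; apply: connect_ind_l; first by rewrite gx eqxx.
move=> f [h1 h2] fh _ IH fx; case/and4P: (fh) => /= /eqP fh1 _ Ah _.
have [h2x|h2x] := eqVneq h2 x.
  by exists f.2; rewrite ?connect0 // fh1 -h2x; apply: connect1.
have [a ha Ca] := IH h2x.
exists a; first exact: connect_trans (connect1 fh) ha.
by apply: connect_trans Ca; apply: connect1; rewrite /avoid /= fx h2x fh1 Ah.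
Qed.

(** If [u] were a head of $T$, a walk in $T$ would lead from [u] to [x], entering first by some
    [(a, x)]. Then [c] reaches [a] through [u] off [x], so [a -> x -> c] is permitted and [(x, c)]
    lies in $T$, against its choice. *)
Lemma escape_disjoint e x u : terminal_arc e -> x \in heads e ->
  u \in escape e x -> u \notin heads e.
Proof.
move=> [Ae te] /headsP[g eg gx] /escapeP[c [xc xcN cu]].
apply/negP => /headsP[f ef fu].
have ux : f.2 != x by rewrite fu (avoid_neqr cu) // eq_sym A_neq.
have fg : connect transition f g by apply: connect_trans (te _ ef) eg.
have [a fa ua] := transition_entry fg ux gx.
have ea := connect_trans ef fa.
have ax := transition_arc Ae ea.
case/negP: xcN; apply: connect_trans ea (connect1 _).
rewrite /transition /= eqxx ax xc; apply: ok_cycle => //.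
by apply: connect_trans cu _; rewrite -fu.
Qed.

(** The gate [g] is the first vertex of [W] on a walk from [x] to [w]; the walk up to [g] misses the
    rest of [W]. *)
Lemma gate (W : {set V}) x w : connect A x w -> w \in W ->
  exists2 g, g \in W & forall y, y \in W -> y != g -> connect (avoid y) x g.
Proof.
move=> xw wW; move: x xw; apply: connect_ind_l => [|x z xz _ [g gW IH]].
  by exists w.
have [xW|xW] := boolP (x \in W); first by exists x.
exists g => // y yW yg; have zg := IH y yW yg.
have zy : z != y by rewrite (avoid_neql zg) // eq_sym.
apply: connect_trans (connect1 _) zg.
by rewrite /avoid /= xz zy andbT; apply: contraNneq xW => ->.
Qed.

Lemma escape_step e x u w : u \in escape e x -> A u w -> w != x ->
  w \in escape e x.
Proof.
case/escapeP=> c [xc xcN cu] uw wx; apply/escapeP; exists c; split=> //.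
have ux : u != x by rewrite (avoid_neqr cu) // eq_sym A_neq.
by apply: connect_trans cu (connect1 _); rewrite /avoid /= uw ux.
Qed.

Lemma connect_A_transition e f : connect transition e f -> connect A e.2 f.2.
Proof.
move: f; apply: connect_ind_r => // f g _ /and4P[/eqP fg _ Ag _] ef.
by apply: connect_trans ef (connect1 _); rewrite fg.
Qed.

Lemma escape_decreases e x :
  terminal_arc e -> x \in heads e -> ~ returning x ->
  exists e' x', [/\ terminal_arc e', x' \in heads e'
                  & #|escape e' x'| < #|escape e x|].
Proof.
move=> te xT; have [Ae eback] := te.
move=> /existsNP[[x0 c] /existsNP[f]].
move=> /not_implyP[/= xc] /not_implyP[/= x0x].
rewrite {}x0x {x0} in xc *.
move=> /not_implyP[/= xf] /not_implyP[/= fx] noret.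
have Af := @transition_arc (x, c) f xc xf.
(* A walk from [f] that met $T$ could be continued inside $T$ to [x], contradicting [noret]. *)
have fN h : connect transition f h -> ~~ connect transition e h.
  move=> fh; apply/negP => eh; case: noret.
  have /headsP[k ek kx] := xT.
  have fk := connect_trans fh (connect_trans (eback _ eh) ek).
  case/connectP: fk => -[|g p] /=; first by move=> _ kf; rewrite -kf kx eqxx in fx.
  case/andP=> fg gp klast; case/and4P: fg => /eqP fg _ Ag _.
  exists g, k; split=> //; by apply/connectP; exists p.
(* Outside $T$ the walk stays in $R$ or at [x]: whenever it passes [x] it leaves by an arc outside
   $T$, hence into $R$ again. *)
have inR h : connect transition (x, c) h -> ~~ connect transition e h ->
    (h.2 == x) || (h.2 \in escape e x).
  move: h; apply: connect_ind_r => [|h [g1 g2] _ hg IH] nT.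
    by apply/orP; right; apply/escapeP; exists c; split; rewrite ?connect0.
  case/and4P: (hg) => /= /eqP hg1 _ Ag _.
  have [//|gx] := eqVneq g2 x.
  have hN : ~~ connect transition e h.
    by apply: contra nT => eh; apply: connect_trans eh (connect1 hg).
  case/orP: (IH hN) => [/eqP hx|hR].
  - apply/escapeP; exists g2; rewrite connect0 -hx hg1.
    by split.
  - by apply: escape_step hR _ gx; rewrite hg1.
have [e' fe' e'back] := connect_terminal transition f.
have Ae' := transition_arc Af fe'.
have te' : terminal_arc e' by [].
have [g gT gateP] : exists2 g, g \in heads e' &
    forall y, y \in heads e' -> y != g -> connect (avoid y) x g.
  apply: (@gate _ x e'.2); last by apply/headsP; exists e'; rewrite ?connect0.
  apply: connect_trans (connect1 xc) _.
  exact: connect_A_transition (connect_trans xf fe').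
(* $T'$ has two distinct heads: that of [e'] and that of a successor arc. *)
have [x' x'T x'g] : exists2 x', x' \in heads e' & x' != g.
  have [->|e'g] := eqVneq g e'.2; last first.
    exists e'.2; last by rewrite eq_sym.
    by apply/headsP; exists e'; rewrite ?connect0.
  case: (e') Ae' => a b /transition_succ[d abd]; exists d => /=.
    by apply/headsP; exists (b, d); rewrite ?connect1.
  by case/and4P: abd => /= _ _ bd _; rewrite eq_sym A_neq.
have xg := gateP _ x'T x'g.
have xx' : x != x' by apply: avoid_neql xg _; rewrite eq_sym.
have x'R : x' \in escape e x.
  have /headsP[h e'h hx'] := x'T; rewrite -hx'.
  have fh := connect_trans fe' e'h.
  have := inR h (connect_trans xf fh) (fN _ fh).
  by rewrite hx' eq_sym (negPf xx').
have disj := escape_disjoint te' x'T.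
(* Strictness is witnessed by [x'], which lies in $R$ but, as a head of $T'$, not in $R'$. *)
exists e', x'; split=> //; apply: proper_card; apply/properP; split; last first.
  by exists x' => //; apply: contraL x'T => /disj.
(* From [x] one reaches [g] off [x'], so [x] in $R'$ would put the head [g] of $T'$ in $R'$. *)
have xNR' : x \notin escape e' x'.
  apply: contraTN gT => /escapeP[d [x'd dN dx]]; apply: disj.
  by apply/escapeP; exists d; split=> //; apply: connect_trans dx xg.
(* Start at [x'] in $R$ and follow the path: $R$ can only be left through [x], which is not in
   $R'$. *)
apply/subsetP => v /escapeP[d [x'd dN dv]].
move: v dv; apply: connect_ind_r => [|u w du uw uR].
  apply: (escape_step x'R x'd); apply: contraNneq xNR' => <-.
  by apply/escapeP; exists d; split; rewrite ?connect0.
have [Auw _ _] := and3P uw.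
apply: (escape_step uR Auw); apply: contraNneq xNR' => <-.
by apply/escapeP; exists d; split=> //; apply: connect_trans du (connect1 uw).
Qed.

Lemma returning_exists a b : A a b -> exists2 x, returning x & exists y, A y x.
Proof.
move=> ab; have [e abe eback] := connect_terminal transition (a, b).
have te : terminal_arc e by split; first exact: transition_arc abe.
have: e.2 \in heads e by apply/headsP; exists e; rewrite ?connect0.
have [n] := ubnP #|escape e e.2|; move: e.2 => x.
elim: n => // n IH in e x te {abe eback} *; rewrite ltnS => le_n xT.
have [rx|nrx] := pselect (returning x).
  exists x => //; have /headsP[f ef <-] := xT.
  by exists f.1; apply: transition_arc ef; case: te.
have [e' [x' [te' x'T lt_R]]] := escape_decreases te xT nrx.
exact: IH te' (leq_trans lt_R le_n) x'T.
Qed.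

End Transitions.

(** * Colours: H-walks as chains of transitions *)

Lemma next_last (T : eqType) (x : T) (s : seq T) :
  uniq (x :: s) -> next (x :: s) (last x s) = x.
Proof.
suff next_atE y : uniq (y :: s) -> next_at (last y s) x y s = x.
  exact: next_atE.
elim: s y => [|z s IH] y; first by rewrite /= eqxx.
rewrite cons_uniq => /andP[yNs us] /=.
by rewrite (negPf (memPn yNs _ _)) ?mem_last // IH.
Qed.

Section Colours.
Variables (V : finType) (E : {set V * V}) (U : Type) (F : U -> U -> Prop).
Variable varsigma : arc_of E -> U.

Definition F_transition (a b c : V) : Prop :=
  forall (ab : (a, b) \in E) (bc : (b, c) \in E),
    F (varsigma (mk_arc ab)) (varsigma (mk_arc bc)).

(** A simple path from [c] to [a] off [b] closes up through [b] into a directed cycle on which [a],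
    [b], [c] are consecutive. *)
Lemma dicycle_F_transition (A : {set V * V}) a b c :
  (forall s, dicycle A s -> H_cycle F varsigma s) ->
  adj A a b -> adj A b c -> b != c -> connect (avoid (adj A) b) c a ->
  F_transition a b c.
Proof.
move=> cycF ab bc nbc /connectP[p0 p0P alast].
case/shortenP: p0P alast => p cp uniq_cp _ alast ab' bc'.
have bNcp : b \notin c :: p.
  rewrite inE (negPf nbc) /=; elim: p c cp {bc nbc uniq_cp alast bc'} => //= d p IH c.
  by case/andP=> /and3P[_ _ db] dp; rewrite inE negb_or eq_sym db (IH d).
have Acp : path (adj A) c p by apply: sub_path cp => u v /andP[].
have [|_] := cycF [:: b, c & p].
  by split; rewrite //= ?bNcp // bc rcons_path Acp -alast.
apply.
- by rewrite alast mem_behead //= mem_last.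
- have ubcp : uniq [:: b, c & p] by rewrite cons_uniq bNcp.
  by rewrite alast -[last c p]/(last b (c :: p)) next_last.
- by rewrite /= eqxx.
Qed.

Lemma H_walk_connect (A : rel V) (ok : V -> V -> V -> bool) a b p z :
  (forall a b c, F_transition a b c -> ok a b c) ->
  path A a (b :: p) -> H_walk F varsigma a (b :: p) z ->
  exists2 f, connect (transition A ok) (a, b) f & f.2 = z.
Proof.
move=> okF Ap [[_ Ep lastz] Fp].
elim: p a b Ap Ep lastz Fp => [|c p IH] a b Ap Ep lastz Fp.
  by exists (a, b).
have /and3P[/= ab bc cp] := Ap.
have [|||f bf fz] := IH b c _ _ lastz.
- by rewrite /= bc.
- by case/andP: Ep.
- by move=> u v w uv vw inf; apply: Fp; rewrite infix_consl inf orbT.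
exists f => //; apply: connect_trans bf; apply: connect1.
rewrite /transition /= eqxx ab bc; apply: okF => ab' bc'.
by apply: Fp; apply: prefixW; rewrite /= !eqxx prefix0s.
Qed.

Lemma connect_H_walk (A : rel V) (ok : V -> V -> V -> bool) a b f :
  (forall a b c, ok a b c -> F_transition a b c) -> subrel A (adj E) ->
  A a b -> connect (transition A ok) (a, b) f ->
  exists q, H_walk F varsigma a q f.2.
Proof.
move=> okF AE ab abf.
suff [p [Ep lastf Fp]] : exists p, [/\ path (adj E) a (b :: p), last b p = f.2
    & forall u v w, infix [:: u; v; w] [:: a, b & p] -> F_transition u v w].
  exists (b :: p); split; first by split.
  by move=> u v w uv vw inf; apply: Fp.
case/connectP: abf => s; elim: s a b ab => [|[b' c] s IH] a b ab /=.
  move=> _ ->; exists [::]; split=> //=; first by rewrite AE.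
  by move=> u v w; rewrite /= !andbF.
case/andP=> /and4P[/= /eqP<- _ bc abc] bs lastf.
have [p [Ep lastp Fp]] := IH b c bc bs lastf.
exists (c :: p); split=> //; first by rewrite /= AE.
move=> u v w; rewrite infix_consl => /orP[|/Fp//].
by rewrite /= => /and4P[/eqP-> /eqP-> /eqP-> _]; apply: okF.
Qed.

End Colours.

(** * The singleton semikernel *)

Theorem theorem2 (V : finType) (E : {set V * V})
    (U : Type) (F : U -> U -> Prop) (varsigma : arc_of E -> U)
    (E1 E2 : {set V * V})
    (V_nonempty : 0 < #|V|)
    (E_loopless : loopless E)
    (E_cover : E = E1 :|: E2)
    (E_disjoint : [disjoint E1 & E2])
    (D2_cycles : forall s : seq V, dicycle E2 s -> H_cycle F varsigma s) :
  exists v : V, H_semikernel_mod F varsigma E1 [set v].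
Proof.
have ED : E :\: E1 = E2.
  rewrite E_cover setDUl setDv set0U; apply/setDidPl.
  by rewrite disjoint_sym.
have E2E : subrel (adj E2) (adj E).
  by move=> u v; rewrite /adj /= E_cover inE => ->; rewrite orbT.
have indep v : H_independent F varsigma [set v].
  by move=> x y /set1P-> /set1P->.
have [v0 _] : exists v, v \in V by apply/card_gt0P.
have [r _ rterm] := connect_terminal (adj E2) v0.
(* The arcs of the terminal strong component of [r] in $D_2$; walks of $D_2$ starting there remain
   in it. *)
pose A : rel V := [rel u v | connect (adj E2) r u && adj E2 u v].
have AE2 : subrel A (adj E2) by move=> u v /andP[].
have A_path u p : connect (adj E2) r u -> path (adj E2) u p -> path A u p.
  elim: p u => //= w p IH u ru /andP[uw wp]; rewrite {1}/A /= ru uw /=.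
  by apply: IH wp; apply: connect_trans ru (connect1 uw).
have [[c rc]|noarc] := pselect (exists c, adj E2 r c); last first.
  (* If no arc of $D_2$ leaves [r], the condition at [r] is vacuous. *)
  exists r; split=> // z zr [_ [[|c p] [/set1P-> rz]]]; first by case: rz => -[].
  by rewrite ED => /andP[rc _]; case: noarc; exists c.
pose ok a b c := `[< F_transition F varsigma a b c >].
have A_irr x : ~~ A x x by apply: contra (E_loopless x) => /AE2/E2E.
have A_cyclic x y : A x y -> connect A y x.
  case/andP=> rx xy; have ry := connect_trans rx (connect1 xy).
  have /connectP[p yp ->] := connect_trans (rterm _ ry) rx.
  by apply/connectP; exists p; rewrite ?A_path.
have ok_cycle a b d : A a b -> A b d -> connect (avoid A b) d a -> ok a b d.
  move=> ab bd da; apply/asboolP.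
  apply: (dicycle_F_transition D2_cycles (AE2 _ _ ab) (AE2 _ _ bd)).
    by apply: contraTneq bd => ->.
  apply: connect_sub da => u v /and3P[uv ub vb]; apply: connect1.
  by rewrite /avoid /= ub vb AE2.
have Arc : A r c by rewrite /A /= connect0.
have [x xret [y yx]] := returning_exists A_irr A_cyclic ok_cycle Arc.
have rx : connect (adj E2) r x.
  by case/andP: yx => ry yx; apply: connect_trans ry (connect1 yx).
exists x; split=> // z; rewrite inE => zx [_ [[|b p] [/set1P-> xz]]].
  by case: xz => -[].
rewrite ED => xp; have Axp := A_path _ _ rx xp.
have okF a b' c' : F_transition F varsigma a b' c' -> ok a b' c'.
  by move=> Fabc; apply/asboolP.
have [f xf fz] := H_walk_connect okF Axp xz.
have Axb : A x b by case/andP: Axp.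
have fx : f.2 != x by rewrite fz.
have [[g1 g2] [h [/= Ag gz gh hx]]] := xret (x, b) f Axb erefl xf fx.
exists x; rewrite -fz -gz -hx.
have [q gq] : exists q, H_walk F varsigma g1 q h.2.
  by apply: connect_H_walk Ag gh => [a b' c' /asboolP|u v /AE2/E2E].
by exists q; rewrite inE.
Qed.
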